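(* Let $Y$ be a nonnegative random variable with nonzero, finite mean $\mu$, and suppose there exists a coupling of $Y$ to a variable $Y^s$ having the $Y$-size bias distribution that satisfies $Y^s\le Y+c$ for some $c>0$ with probability one. Then $$P(Y-\mu\ge t)\le\exp\left(-\frac{t^2}{2c\mu+2ct/3}\right)\qquad\text{for all } t>0.$$
   Context: For a nonnegative random variable $Y$ with finite positive mean $\mu$, a random variable $Y^s$ has the $Y$-size bias distribution if $E[Yf(Y)]=\mu E[f(Y^s)]$ for all functions $f$ for which these expectations exist. *)

(* Defs.v *)
From HB Require Import structures.
From mathcomp Require Import all_boot all_order all_algebra.
From mathcomp Require Import all_classical all_reals all_analysis.

Set Implicit Arguments.
Unset Strict Implicit.
Unset Printing Implicit Defensive.

Import Order.TTheory GRing.Theory Num.Theory.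
Import numFieldNormedType.Exports.

Local Open Scope classical_set_scope.
Local Open Scope ring_scope.

(* Equality is required on measurable sets only: as functions on all subsets of
   [R], the two pushforwards could differ on nonmeasurable sets. *)
Definition same_distribution (R : realType)
    (d1 d2 : measure_display)
    (T1 : measurableType d1) (T2 : measurableType d2)
    (P1 : probability T1 R) (P2 : probability T2 R)
    (X1 : {RV P1 >-> R}) (X2 : {RV P2 >-> R}) : Prop :=
  forall A : set R, measurable A ->
    distribution P1 X1 A = distribution P2 X2 A.

(* [Ys] has the [Y]-size bias distribution. Expectations in [\bar R] are total,
   so "these expectations exist" becomes integrability of both integrands. *)
Definition has_size_bias_distribution (R : realType)
    (d1 d2 : measure_display)
    (T1 : measurableType d1) (T2 : measurableType d2)
    (P1 : probability T1 R) (P2 : probability T2 R)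
    (Y : {RV P1 >-> R}) (Ys : {RV P2 >-> R}) : Prop :=
  forall f : R -> R, measurable_fun [set: R] f ->
    P1.-integrable [set: T1] (fun w => (Y w * f (Y w))%:E) ->
    P2.-integrable [set: T2] (fun w => (f (Ys w))%:E) ->
    ('E_P1[fun w => (Y w * f (Y w))%R] = 'E_P1[Y] * 'E_P2[fun w => f (Ys w)])%E.

(* A coupling may live on a space other than that of [Y], hence the copy [Y']. *)
Definition bounded_size_bias_coupling (R : realType)
    (d : measure_display) (T : measurableType d) (P : probability T R)
    (Y : {RV P >-> R}) (c : R) : Prop :=
  exists (d' : measure_display) (T' : measurableType d')
      (P' : probability T' R) (Y' Ys : {RV P' >-> R}),
    [/\ same_distribution Y' Y,
        has_size_bias_distribution Y Ys
      & \forall w \ae P', Ys w <= Y' w + c].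

(* Main.v *)
(** Applied to the indicator of [x, +oo[, the size-bias identity and
    Y^s <= Y + c give
    x P(Y >= x) <= E[Y 1(Y >= x)] = mu P(Y^s >= x) <= mu P(Y >= x - c).
    With x = mu + t, each step of length c therefore gains a factor
    mu / (mu + t) on the tail. The exponent H(t) = (mu / c) q(t / mu), with
    q(u) = u^2 / (2 + 2 u / 3), grows by at most ln (1 + t / mu) over such a
    step, because q is convex and q'(u) <= ln (1 + u); so the bound propagates
    from P <= 1 at t <= 0. *)

Require Import Defs.
From HB Require Import structures.
From mathcomp Require Import all_boot all_order all_algebra.
From mathcomp Require Import all_classical all_reals all_analysis.
From mathcomp Require Import measurable_realfun ring lra.

Import Order.TTheory GRing.Theory Num.Theory.
Import numFieldNormedType.Exports.

Local Open Scope classical_set_scope.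
Local Open Scope ring_scope.

Set Implicit Arguments.
Unset Strict Implicit.

(* The left-hand side is the derivative of u^2 / (2 + 2 u / 3). *)
Lemma ln1D_ge (R : realType) (u : R) :
  0 <= u -> 3 / 2 * (1 - ((1 + u / 3) ^+ 2)^-1) <= ln (1 + u).
Proof.
move=> u0.
(* Since [g 0] is 3/2, the claim is [g 0 <= g u], so monotonicity of [g] on [0, u] suffices. *)
pose g (x : R) := ln (1 + x) + 3 / 2 * ((1 + x / 3) ^+ 2)^-1.
have dg (x : R) : 0 <= x ->
    is_derive x 1 g ((1 + x)^-1 - ((1 + x / 3) ^+ 3)^-1).
  move=> x0.
  have x1 : 0 < 1 + x by lra.
  have x3 : 1 + x / 3 != 0 by apply/eqP; lra.
  have dln : is_derive x 1 (fun y => ln (1 + y)) (1 + x)^-1.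
    have dl := is_derive1_ln x1.
    have dD : is_derive x 1 (fun y : R => 1 + y) 1.
      by rewrite -[X in is_derive _ _ _ X]add0r; apply: is_deriveD.
    have := @is_derive1_comp R (@ln R) (fun y : R => 1 + y) x _ _ dl dD.
    by rewrite mulr1.
  have dsq : is_derive x 1 (fun y : R => (1 + y / 3) ^+ 2)
      (2 * (1 + x / 3) / 3).
    by apply: is_derive_eq; rewrite /GRing.scale/=; field.
  have x3' : (1 + x / 3) ^+ 2 != 0 by rewrite expf_neq0.
  have dV := is_deriveV (f := fun y : R => (1 + y / 3) ^+ 2) x3' dsq.
  rewrite /g; apply: is_derive_eq.
  by rewrite /GRing.scale/=; field; apply/andP; split; apply/eqP; lra.
have : g 0 <= g u.
  apply: (@ger0_derive1_ndecr _ g 0 u) => //.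
  - by move=> x; rewrite in_itv/= => /andP[/ltW x0 _]; have [] := dg x x0.
  - move=> x; rewrite in_itv/= => /andP[/ltW x0 _].
    have d := dg x x0.
    (* The sign of the derivative reduces to 1 + x <= (1 + x / 3)^3. *)
    rewrite derive1E derive_val subr_ge0 lef_pV2 ?posrE; last lra.
      have -> : (1 + x / 3) ^+ 3 = 1 + x + (x ^+ 2 / 3 + x ^+ 3 / 27) by field.
      by rewrite lerDl addr_ge0 ?divr_ge0 ?exprn_ge0.
    by rewrite exprn_gt0//; lra.
  - apply: derivable_within_continuous => x.
    by rewrite in_itv/= => /andP[x0 _]; have [] := dg x x0.
rewrite /g mul0r addr0 ln1 expr1n invr1; lra.
Qed.

(** The tangent at u lies below the convex q, so q(u) - q(v) <= (u - v) q'(u), and [ln1D_ge] bounds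
    q'(u). *)
Lemma bernstein_rate_increment (R : realType) (u v : R) : 0 <= v -> v <= u ->
  u ^+ 2 / (2 + 2 * u / 3) - v ^+ 2 / (2 + 2 * v / 3) <= (u - v) * ln (1 + u).
Proof.
move=> v0 vu.
have u0 : 0 <= u by lra.
apply: (@le_trans _ _ ((u - v) * (3 / 2 * (1 - ((1 + u / 3) ^+ 2)^-1))));
  last by rewrite ler_wpM2l ?subr_ge0// ln1D_ge.
rewrite -subr_ge0.
(* The gap to the tangent is an explicit nonnegative fraction, which replaces an appeal to
   convexity. *)
suff -> : (u - v) * (3 / 2 * (1 - ((1 + u / 3) ^+ 2)^-1)) -
  (u ^+ 2 / (2 + 2 * u / 3) - v ^+ 2 / (2 + 2 * v / 3)) =
  27 / 2 * (u - v) ^+ 2 / ((3 + u) ^+ 2 * (3 + v)).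
  by rewrite divr_ge0 ?mulr_ge0 ?sqr_ge0//; lra.
field; do ?[apply/andP; split]; apply/eqP; lra.
Qed.

(** With u = t / m and v = s / m, the exponent grows by at most ((t - s) / c) ln (1 + t / m). Steps
    shorter than c are allowed, for the one that is cut off at 0. *)
Lemma bernstein_exponent_step (R : realType) (m c s t : R) :
  0 < m -> 0 < c -> 0 <= s -> s <= t -> t - s <= c ->
  m / (m + t) * expR (- (s ^+ 2 / (2 * c * m + 2 * c * s / 3))) <=
  expR (- (t ^+ 2 / (2 * c * m + 2 * c * t / 3))).
Proof.
move=> m0 c0 s0 st tsc.
have t0 : 0 <= t by lra.
have scaled (r : R) : 0 <= r -> r ^+ 2 / (2 * c * m + 2 * c * r / 3) =
    m / c * ((r / m) ^+ 2 / (2 + 2 * (r / m) / 3)).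
  move=> r0; field; apply/and4P; split; apply/eqP; try lra.
    suff : 0 < 6 * c * m + 2 * c * r by lra.
    by rewrite ltr_wpDr ?mulr_ge0 ?mulr_gt0 //; lra.
have um : 0 <= t / m by rewrite divr_ge0 // ltW.
have L0 : 0 <= ln (1 + t / m) by apply: ln_ge0; lra.
have sm : 0 <= s / m by rewrite divr_ge0 // ltW.
have stm : s / m <= t / m by rewrite ler_pM2r ?invr_gt0.
have mt0 : 0 < m + t by lra.
have -> : m / (m + t) = expR (- ln (1 + t / m)).
  rewrite expRN lnK ?posrE; last lra.
  by field; apply/andP; split; apply/eqP; lra.
rewrite -expRD ler_expR !scaled // -opprD lerN2 -lerBlDr -mulrBr.
apply: (@le_trans _ _ (m / c * ((t / m - s / m) * ln (1 + t / m)))).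
  by rewrite ler_wpM2l ?divr_ge0 ?bernstein_rate_increment // ltW.
rewrite mulrA; apply: ler_piMl => //.
have -> : m / c * (t / m - s / m) = (t - s) / c.
  by field; apply/andP; split; apply/eqP; lra.
by rewrite ler_pdivrMr // mul1r.
Qed.

(** Almost everywhere [Y] equals [|Y|], whose integral is nonnegative. *)
Lemma mean_gt0 (R : realType) (d : measure_display) (T : measurableType d)
    (P : probability T R) (Y : {RV P >-> R}) (mu : R) :
  (\forall w \ae P, 0 <= Y w) -> ('E_P[Y] = mu%:E)%E -> mu != 0 -> 0 < mu.
Proof.
move=> Y0 EY mu0; rewrite lt_neqAle eq_sym mu0/= -lee_fin -EY unlock.
rewrite (ae_eq_integral (fun w => `|Y w|%:E)) ?integral_ge0 //.
- exact/measurable_EFinP.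
- by apply/measurable_EFinP; exact: measurableT_comp.
- by apply: filterS Y0 => w Yw _; rewrite ger0_norm.
Qed.

(** The integral of [|Y|] is that of [Y], hence finite. This supplies the integrability that the
    size-bias identity asks for. *)
Lemma ae_ge0_integrable (R : realType) (d : measure_display)
    (T : measurableType d) (P : probability T R) (Y : {RV P >-> R}) (mu : R) :
  (\forall w \ae P, 0 <= Y w) -> ('E_P[Y] = mu%:E)%E ->
  P.-integrable [set: T] (EFin \o Y).
Proof.
move=> Y0 EY; apply/integrableP; split; first exact/measurable_EFinP.
rewrite (ae_eq_integral (EFin \o Y)) //.
- by move: EY; rewrite unlock => ->; exact: ltry.
- by apply: measurableT_comp => //; exact/measurable_EFinP.
- exact/measurable_EFinP.
- by apply: filterS Y0 => w Yw _ /=; rewrite ger0_norm.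
Qed.

Lemma tail_preimage (R : realType) (T : Type) (X : T -> R) (z : R) :
  [set w | z <= X w] = X @^-1` `[z, +oo[.
Proof. by apply/seteqP; split=> w; rewrite /= in_itv/= andbT. Qed.

Lemma measurable_tail (R : realType) (d : measure_display)
    (T : measurableType d) (P : probability T R) (X : {RV P >-> R}) (z : R) :
  measurable [set w | z <= X w].
Proof.
by rewrite tail_preimage -[X in measurable X]setTI; exact: measurable_funPT.
Qed.

Lemma size_bias_tail_recursion (R : realType) (d : measure_display)
    (T : measurableType d) (P : probability T R) (Y : {RV P >-> R})
    (mu c x : R) :
  (\forall w \ae P, 0 <= Y w) -> ('E_P[Y] = mu%:E)%E -> 0 <= mu ->
  bounded_size_bias_coupling Y c -> 0 < x ->
  (x%:E * P [set w | (x <= Y w)%R] <=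
   mu%:E * P [set w | (x - c <= Y w)%R])%E.
Proof.
move=> Y0 EY mu0 [d' [T' [P' [Y' [Ys [same bias bound]]]]]] x0.
pose f : R -> R := \1_(`[x, +oo[).
have mf : measurable_fun setT f.
  by apply: measurable_indic; exact: measurable_itv.
have fE S (X : S -> R) : (fun w => f (X w)) = \1_[set w | x <= X w].
  by rewrite tail_preimage.
have xY w : x * f (Y w) <= Y w * f (Y w).
  rewrite /f indicE mem_setE in_itv/= andbT.
  by case: (leP x (Y w)) => ? /=; rewrite ?mulr1 ?mulr0.
have f0 y : 0 <= f y by rewrite /f indicE.
(* This holds at every point, even where [Y] is negative, because [f] vanishes below x > 0. *)
have Yf0 w : 0 <= Y w * f (Y w).
  by apply: le_trans (xY w); rewrite mulr_ge0// ltW.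
have mfY : measurable_fun setT (fun w => f (Y w)) by exact: measurableT_comp.
have mYf : measurable_fun setT (fun w => Y w * f (Y w)).
  exact: measurable_funM.
(* The integrand is dominated by [|Y|]. *)
have iYf : P.-integrable [set: T] (fun w => (Y w * f (Y w))%:E).
  apply: (@le_integrable _ T R P setT measurableT _ (EFin \o Y));
    last exact: ae_ge0_integrable Y0 EY.
    exact/measurable_EFinP.
  move=> w _ /=; rewrite lee_fin normrM ler_piMr //.
  by rewrite /f indicE; case: (_ \in _); rewrite ?normr1 ?normr0.
have ifYs : P'.-integrable [set: T'] (fun w => (f (Ys w))%:E).
  have := integrable_indic P' (measurable_tail Ys x).
  by rewrite -fE.
have := bias f mf iYf ifYs.
rewrite EY fE expectation_indic; last exact: measurable_tail.
move=> EYf.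
apply: (@le_trans _ _ ('E_P[fun w => (Y w * f (Y w))%R])%E).
  rewrite -expectation_indic; last exact: measurable_tail.
  rewrite -fE unlock -ge0_integralZl_EFin //.
  - apply: ge0_le_integral => //.
    + by move=> w _; rewrite -EFinM lee_fin mulr_ge0// ltW.
    + by apply/measurable_EFinP; exact: measurable_funM.
    + exact/measurable_EFinP.
    + by move=> w _; rewrite -EFinM lee_fin.
  - by move=> w _; rewrite lee_fin.
  - exact/measurable_EFinP.
  - exact: ltW.
rewrite EYf; apply: lee_wpmul2l; first by rewrite lee_fin.
(* Equality in law moves the event to the coupling space, where [Ys] and [Y'] can be compared
   pointwise. *)
have -> : P [set w | (x - c <= Y w)%R] = P' [set w | (x - c <= Y' w)%R].
  by rewrite !tail_preimage; exact/esym/same.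
rewrite -!expectation_indic; try exact: measurable_tail.
apply: expectation_le => //; try exact/measurable_indic/measurable_tail.
apply: filterS bound => w YsY; rewrite !indicE ler_nat.
have [xYs|//] := boolP (w \in [set w | x <= Ys w]).
rewrite mem_set //=; move: xYs; rewrite inE /= => xYs.
by rewrite lerBlDr (le_trans xYs).
Qed.

(** Induction on a number n of steps of length c that suffices to go from t down to 0. *)
Lemma bounded_size_bias_tail (R : realType) (d : measure_display)
    (T : measurableType d) (P : probability T R) (Y : {RV P >-> R})
    (mu c t : R) :
  (\forall w \ae P, 0 <= Y w) -> ('E_P[Y] = mu%:E)%E -> 0 < mu -> 0 < c ->
  bounded_size_bias_coupling Y c -> 0 <= t ->
  (P [set w | (mu + t <= Y w)%R] <=
   (expR (- (t ^+ 2 / (2 * c * mu + 2 * c * t / 3))))%:E)%E.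
Proof.
move=> Y0 EY mu0 c0 coupling t0.
have [n] : exists n : nat, t <= n%:R * c.
  exists (Num.bound (t / c)); rewrite -ler_pdivrMr //.
  by rewrite ltW // archi_boundP // divr_ge0 // ltW.
elim: n t t0 => [|n IHn] t t0 tn.
  have -> : t = 0 by lra.
  by rewrite expr0n mul0r oppr0 expR0; exact/probability_le1/measurable_tail.
have mt0 : 0 < mu + t by lra.
have rec := size_bias_tail_recursion Y0 EY (ltW mu0) coupling mt0.
(* The step is truncated at 0: if t < c, the bound at s = 0 is 1 and holds trivially; otherwise the
   induction hypothesis applies at t - c. *)
pose s := Num.max 0 (t - c).
have s0 : 0 <= s by rewrite le_max lexx.
have st : s <= t by rewrite ge_max t0 lerBlDr lerDl ltW.
have tsc : t - s <= c by rewrite lerBlDl -lerBlDr le_max lexx orbT.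
have step := bernstein_exponent_step mu0 c0 s0 st tsc.
apply: le_trans (_ : _ <= (mu / (mu + t) * _)%:E)%E _; last first.
  by rewrite lee_fin; exact: step.
have bound_s : (P [set w | (mu + t - c <= Y w)%R] <=
   (expR (- (s ^+ 2 / (2 * c * mu + 2 * c * s / 3))))%:E)%E.
  rewrite /s; case: (leP 0 (t - c)) => tc.
    rewrite -addrA; apply: IHn => //.
    by rewrite lerBlDr; move: tn; rewrite -natr1 mulrDl mul1r.
  by rewrite expr0n mul0r oppr0 expR0; exact/probability_le1/measurable_tail.
rewrite -mulrA mulrCA EFinM lee_pdivlMl //.
apply: (le_trans rec); rewrite EFinM.
by apply: lee_wpmul2l => //; rewrite lee_fin ltW.
Qed.

Unset Implicit Arguments.
Set Strict Implicit.

Theorem corollary1p1 (R : realType)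
    (d : measure_display) (T : measurableType d) (P : probability T R)
    (Y : {RV P >-> R}) (mu c : R)
    (Y_ge0 : \forall w \ae P, 0 <= Y w)
    (Y_mean : ('E_P[Y] = mu%:E)%E)
    (mu_neq0 : mu != 0)
    (c_gt0 : 0 < c)
    (coupling : bounded_size_bias_coupling Y c) :
  forall t : R, 0 < t ->
    (P [set w | (t <= Y w - mu)%R] <=
     (expR (- (t ^+ 2 / (2 * c * mu + 2 * c * t / 3))))%:E)%E.
Proof.
move=> t t0; have mu0 := mean_gt0 Y_ge0 Y_mean mu_neq0.
under eq_set do rewrite lerBrDl.
exact: bounded_size_bias_tail (ltW t0).
Qed.
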